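(* Let $\mathcal{C}$ be a monoidal category with coequalizers, and assume that the unit object $\underline{1}$ is a left $\otimes$-generator of $\mathcal{C}$. Let $i:R\to S$ be an algebra morphism in $\mathcal{C}$ with $S$ a left coflat object. Then: (i) If every object of $\mathcal{C}$ is right coflat, then the restriction of scalars functor $F:\mathcal{C}_S\to\mathcal{C}_R$ is separable if and only if there exists a morphism $e:\underline{1}\to S\otimes_RS$ in $\mathcal{C}$ such that $\mu^S_{S\otimes_RS}(\mathrm{Id}_S\otimes e)=\nu^S_{S\otimes_RS}(e\otimes\mathrm{Id}_S)$ and $m^R_S\,e=\eta_S$. (ii) The induction functor $-\otimes_RS:\mathcal{C}_R\to\mathcal{C}_S$ is separable if and only if there exists an $R$-bimodule morphism $\vartheta:S\to R$ such that $\vartheta\,\eta_S=\eta_R$.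
   Context: Monoidal categories are taken strict, with tensor product $\otimes$ and unit object $\underline{1}$. For an algebra $A$ in $\mathcal{C}$, $m_A$ and $\eta_A$ are its multiplication and unit; $\mathcal{C}_A$, ${}_A\mathcal{C}$ are the categories of right and left $A$-modules in $\mathcal{C}$. An object $P$ of $\mathcal{C}$ is a left $\otimes$-generator of $\mathcal{C}$ if, whenever $f,g:Y\otimes Z\to W$ satisfy $f(\epsilon\otimes\mathrm{Id}_Z)=g(\epsilon\otimes\mathrm{Id}_Z)$ for all $\epsilon:P\to Y$ in $\mathcal{C}$, then $f=g$. An object $X$ is right (respectively left) coflat if $X\otimes-$ (respectively $-\otimes X$) preserves coequalizers. For an algebra $R$, $X\in\mathcal{C}_R$ with action $\nu^R_X$ and $Y\in{}_R\mathcal{C}$ with action $\mu^R_Y$, $q^R_{X,Y}:X\otimes Y\to X\otimes_RY$ denotes the coequalizer of $\nu^R_X\otimes\mathrm{Id}_Y$ and $\mathrm{Id}_X\otimes\mu^R_Y$. $S$ is an $R$-bimodule via $i$ and $m_S$. The actions of $S$ on $S\otimes_RS$ are determined by $\mu^S_{S\otimes_RS}(\mathrm{Id}_S\otimes q^R_{S,S})=q^R_{S,S}(m_S\otimes\mathrm{Id}_S)$ and $\nu^S_{S\otimes_RS}(q^R_{S,S}\otimes\mathrm{Id}_S)=q^R_{S,S}(\mathrm{Id}_S\otimes m_S)$. The morphism $m^R_S:S\otimes_RS\to S$ is the unique one with $m^R_Sq^R_{S,S}=m_S$. The restriction of scalars functor $F:\mathcal{C}_S\to\mathcal{C}_R$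 sends $(M,\nu^S_M)$ to $(M,\nu^S_M(\mathrm{Id}_M\otimes i))$ and is the identity on morphisms. The induction functor $-\otimes_RS:\mathcal{C}_R\to\mathcal{C}_S$ sends $X$ to $X\otimes_RS$ with right $S$-action $\nu^S$ determined by $\nu^S(q^R_{X,S}\otimes\mathrm{Id}_S)=q^R_{X,S}(\mathrm{Id}_X\otimes m_S)$, and sends $f:X\to Y$ to the morphism $\hat f$ with $\hat fq^R_{X,S}=q^R_{Y,S}(f\otimes\mathrm{Id}_S)$. A functor $\mathcal{F}:\mathcal{D}\to\mathcal{E}$ is separable if for all objects $X,Y$ of $\mathcal{D}$ there is a map $\mathcal{P}_{X,Y}:\mathrm{Hom}_{\mathcal{E}}(\mathcal{F}(X),\mathcal{F}(Y))\to\mathrm{Hom}_{\mathcal{D}}(X,Y)$ such that $\mathcal{P}_{X,Y}(\mathcal{F}(f))=f$ for all $f:X\to Y$, and $\mathcal{P}_{Y_1,Y_2}(g_2)\circ f_1=f_2\circ\mathcal{P}_{X_1,X_2}(g_1)$ whenever $f_1:X_1\to Y_1$, $f_2:X_2\to Y_2$ in $\mathcal{D}$ and $g_1:\mathcal{F}(X_1)\to\mathcal{F}(X_2)$, $g_2:\mathcal{F}(Y_1)\to\mathcal{F}(Y_2)$ in $\mathcal{E}$ satisfy $g_2\circ\mathcal{F}(f_1)=\mathcal{F}(f_2)\circ g_1$. *)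

(* Defs.v *)
From Stdlib Require Import ssreflect ProofIrrelevance IndefiniteDescription.

Set Implicit Arguments.
Unset Strict Implicit.
Unset Printing Implicit Defensive.

(** * Categories and functors *)

Record Category := MkCategory {
  Obj :> Type;
  Hom : Obj -> Obj -> Type;
  idm : forall X, Hom X X;
  comp : forall X Y Z, Hom Y Z -> Hom X Y -> Hom X Z;
  comp_idl : forall X Y (f : Hom X Y), comp (idm Y) f = f;
  comp_idr : forall X Y (f : Hom X Y), comp f (idm X) = f;
  comp_assoc : forall X Y Z W (h : Hom Z W) (g : Hom Y Z) (f : Hom X Y),
    comp (comp h g) f = comp h (comp g f)
}.

Arguments Hom {c} X Y.
Arguments idm {c} X.
Arguments comp {c X Y Z} g f.

Declare Scope cat_scope.
Open Scope cat_scope.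
Notation "g \o f" := (comp g f)
  (at level 50, left associativity, format "g  \o  f") : cat_scope.

Record Functor (D E : Category) := MkFunctor {
  fobj :> D -> E;
  fmap : forall X Y : D, Hom X Y -> Hom (fobj X) (fobj Y);
  fmap_id : forall X : D, fmap (idm X) = idm (fobj X);
  fmap_comp : forall (X Y Z : D) (g : Hom Y Z) (f : Hom X Y),
    fmap (g \o f) = fmap g \o fmap f
}.

Arguments fmap {D E} F {X Y} f : rename.

Definition separable (D E : Category) (F : Functor D E) : Prop :=
  exists P : forall X Y : D, Hom (F X) (F Y) -> Hom X Y,
    (forall (X Y : D) (f : Hom X Y), P X Y (fmap F f) = f) /\
    (forall (X1 X2 Y1 Y2 : D) (f1 : Hom X1 Y1) (f2 : Hom X2 Y2)
        (g1 : Hom (F X1) (F X2)) (g2 : Hom (F Y1) (F Y2)),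
      g2 \o fmap F f1 = fmap F f2 \o g1 ->
      P Y1 Y2 g2 \o f1 = f2 \o P X1 X2 g1).

(** * Coequalizers *)

Definition is_coequalizer (C : Category) (X Y Q : C) (f g : Hom X Y)
    (q : Hom Y Q) : Prop :=
  q \o f = q \o g /\
  forall (Z : C) (h : Hom Y Z), h \o f = h \o g ->
    exists! k : Hom Q Z, k \o q = h.

Record Coequalizer (C : Category) (X Y : C) (f g : Hom X Y) := MkCoequalizer {
  coeq_obj : C;
  coeq_map : Hom Y coeq_obj;
  coeq_is : is_coequalizer f g coeq_map
}.

(* A choice of coequalizers, so that [X (x)_R Y] below is an object of [C] rather
   than an isomorphism class. *)
Definition Coequalizers (C : Category) : Type :=
  forall (X Y : C) (f g : Hom X Y), Coequalizer f g.

Definition coeq_desc (C : Category) (X Y Q Z : C) (f g : Hom X Y)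
    (q : Hom Y Q) (H : is_coequalizer f g q) (h : Hom Y Z)
    (e : h \o f = h \o g) : Hom Q Z :=
  proj1_sig (constructive_indefinite_description _ (proj2 H Z h e)).

Lemma coeq_descE (C : Category) (X Y Q Z : C) (f g : Hom X Y)
    (q : Hom Y Q) (H : is_coequalizer f g q) (h : Hom Y Z)
    (e : h \o f = h \o g) : coeq_desc H e \o q = h.
Proof. by rewrite /coeq_desc; case: constructive_indefinite_description => k []. Qed.

Lemma coeq_epi (C : Category) (X Y Q Z : C) (f g : Hom X Y)
    (q : Hom Y Q) (H : is_coequalizer f g q) (k1 k2 : Hom Q Z) :
  k1 \o q = k2 \o q -> k1 = k2.
Proof.
move=> e; have e' : (k2 \o q) \o f = (k2 \o q) \o g.
  by rewrite !comp_assoc (proj1 H).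
case: (proj2 H Z (k2 \o q) e') => k [_ u].
by rewrite -(u k1 e) -(u k2 eq_refl).
Qed.

(** * Strict monoidal categories *)

(* Equal objects have different Hom types in general, so strictness is stated
   along the identity of [X], seen as a morphism [X -> Y] when [X = Y]. *)
Definition eqhom (C : Category) (X Y : C) (e : X = Y) : Hom X Y :=
  match e with eq_refl => idm X end.

Record StrictMonoidalCategory := MkStrictMonoidalCategory {
  mcat :> Category;
  tens : mcat -> mcat -> mcat;
  tensm : forall X X' Y Y' : mcat,
    Hom X X' -> Hom Y Y' -> Hom (tens X Y) (tens X' Y');
  tunit : mcat;
  tensm_id : forall X Y, tensm (idm X) (idm Y) = idm (tens X Y);
  tensm_comp : forall X X' X'' Y Y' Y'' (f' : Hom X' X'') (f : Hom X X')
      (g' : Hom Y' Y'') (g : Hom Y Y'),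
    tensm (f' \o f) (g' \o g) = tensm f' g' \o tensm f g;
  tensA : forall X Y Z, tens (tens X Y) Z = tens X (tens Y Z);
  tens1l : forall X, tens tunit X = X;
  tens1r : forall X, tens X tunit = X;
  tensmA : forall X X' Y Y' Z Z' (f : Hom X X') (g : Hom Y Y') (h : Hom Z Z'),
    eqhom (tensA X' Y' Z') \o tensm (tensm f g) h =
    tensm f (tensm g h) \o eqhom (tensA X Y Z);
  tensm1l : forall X X' (f : Hom X X'),
    eqhom (tens1l X') \o tensm (idm tunit) f = f \o eqhom (tens1l X);
  tensm1r : forall X X' (f : Hom X X'),
    eqhom (tens1r X') \o tensm f (idm tunit) = f \o eqhom (tens1r X)
}.

Arguments tens {s} X Y.
Arguments tensm {s X X' Y Y'} f g.
Arguments tunit s : clear implicits.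

Notation "X (x) Y" := (tens X Y)
  (at level 40, left associativity) : cat_scope.
Notation "f <x> g" := (tensm f g)
  (at level 40, left associativity) : cat_scope.

(* The identities (X Y) Z = X (Y Z), 1 X = X and X 1 = X, left implicit on
   paper. *)
Section Identifications.
Variable C : StrictMonoidalCategory.

Definition asc (X Y Z : C) : Hom ((X (x) Y) (x) Z) (X (x) (Y (x) Z)) :=
  eqhom (tensA X Y Z).
Definition asc_inv (X Y Z : C) : Hom (X (x) (Y (x) Z)) ((X (x) Y) (x) Z) :=
  eqhom (eq_sym (tensA X Y Z)).
Definition lun (X : C) : Hom (tunit C (x) X) X := eqhom (tens1l X).
Definition lun_inv (X : C) : Hom X (tunit C (x) X) := eqhom (eq_sym (tens1l X)).
Definition run (X : C) : Hom (X (x) tunit C) X := eqhom (tens1r X).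
Definition run_inv (X : C) : Hom X (X (x) tunit C) := eqhom (eq_sym (tens1r X)).

End Identifications.

Arguments asc {C} X Y Z.
Arguments asc_inv {C} X Y Z.
Arguments lun {C} X.
Arguments lun_inv {C} X.
Arguments run {C} X.
Arguments run_inv {C} X.

Section Coherence.
Variable C : StrictMonoidalCategory.

Lemma eqhom_comp (X Y Z : C) (e : X = Y) (e' : Y = Z) :
  eqhom e' \o eqhom e = eqhom (eq_trans e e').
Proof. by case: Z / e'; case: Y / e; rewrite /= comp_idl. Qed.

Lemma eqhom_tensr (W X Y : C) (e : X = Y) :
  idm W <x> eqhom e = eqhom (f_equal (tens W) e).
Proof. by case: Y / e; rewrite /= tensm_id. Qed.

Lemma eqhom_tensl (W X Y : C) (e : X = Y) :
  eqhom e <x> idm W = eqhom (f_equal (fun V => V (x) W) e).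
Proof. by case: Y / e; rewrite /= tensm_id. Qed.

Lemma eqhom_irr (X Y : C) (e e' : X = Y) : eqhom e = eqhom e'.
Proof. by rewrite (proof_irrelevance _ e e'). Qed.

Lemma pentagon (X Y Z W : C) :
  idm X <x> asc Y Z W \o (asc X (Y (x) Z) W \o asc X Y Z <x> idm W) =
  asc X Y (Z (x) W) \o asc (X (x) Y) Z W.
Proof. rewrite /asc eqhom_tensr eqhom_tensl !eqhom_comp; exact: eqhom_irr. Qed.

Lemma pentagon_inv (X Y Z W : C) :
  asc (X (x) Y) Z W \o (asc_inv X Y Z <x> idm W \o asc_inv X (Y (x) Z) W) =
  asc_inv X Y (Z (x) W) \o idm X <x> asc Y Z W.
Proof.
rewrite /asc /asc_inv eqhom_tensr eqhom_tensl !eqhom_comp; exact: eqhom_irr.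
Qed.

Lemma triangle_r (X Y : C) :
  idm X <x> run Y \o asc X Y (tunit C) = run (X (x) Y).
Proof. rewrite /asc /run eqhom_tensr !eqhom_comp; exact: eqhom_irr. Qed.

Lemma eqhomK (X Y : C) (e : X = Y) : eqhom (eq_sym e) \o eqhom e = idm X.
Proof. by case: Y / e; rewrite /= comp_idl. Qed.

Lemma eqhom_symK (X Y : C) (e : X = Y) : eqhom e \o eqhom (eq_sym e) = idm Y.
Proof. by case: Y / e; rewrite /= comp_idl. Qed.

Lemma ascK (X Y Z : C) : asc_inv X Y Z \o asc X Y Z = idm _.
Proof. exact: eqhomK. Qed.

Lemma asc_invK (X Y Z : C) : asc X Y Z \o asc_inv X Y Z = idm _.
Proof. exact: eqhom_symK. Qed.

Lemma runK (X : C) : run_inv X \o run X = idm _.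
Proof. exact: eqhomK. Qed.

Lemma run_invK (X : C) : run X \o run_inv X = idm _.
Proof. exact: eqhom_symK. Qed.

Lemma asc_nat (X X' Y Y' Z Z' : C) (f : Hom X X') (g : Hom Y Y') (h : Hom Z Z') :
  asc X' Y' Z' \o (f <x> g) <x> h = f <x> (g <x> h) \o asc X Y Z.
Proof. exact: tensmA. Qed.

Lemma asc_inv_nat (X X' Y Y' Z Z' : C) (f : Hom X X') (g : Hom Y Y')
    (h : Hom Z Z') :
  asc_inv X' Y' Z' \o f <x> (g <x> h) = (f <x> g) <x> h \o asc_inv X Y Z.
Proof.
rewrite -[LHS]comp_idr -(asc_invK X Y Z) !comp_assoc.
rewrite -(comp_assoc (f <x> (g <x> h))) -asc_nat.
by rewrite !comp_assoc -(comp_assoc (asc_inv X' Y' Z')) ascK comp_idl.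
Qed.

Lemma run_inv_nat (X X' : C) (f : Hom X X') :
  f <x> idm (tunit C) \o run_inv X = run_inv X' \o f.
Proof.
rewrite -[LHS]comp_idl -(runK X') !comp_assoc -(comp_assoc (run X')).
by rewrite /run tensm1r -/(run X) !comp_assoc run_invK comp_idr.
Qed.

Lemma tensm_compl (W X Y Z : C) (g : Hom Y Z) (f : Hom X Y) :
  (g \o f) <x> idm W = g <x> idm W \o f <x> idm W.
Proof. by rewrite -tensm_comp comp_idl. Qed.

Lemma tensm_compr (W X Y Z : C) (g : Hom Y Z) (f : Hom X Y) :
  idm W <x> (g \o f) = idm W <x> g \o idm W <x> f.
Proof. by rewrite -tensm_comp comp_idl. Qed.

Lemma tensm_swap (X X' Y Y' : C) (f : Hom X X') (g : Hom Y Y') :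
  f <x> idm Y' \o idm X <x> g = idm X' <x> g \o f <x> idm Y.
Proof. by rewrite -!tensm_comp !comp_idl !comp_idr. Qed.

End Coherence.

(** * Generators and coflatness *)

Definition left_tensor_generator (C : StrictMonoidalCategory) (P : C) : Prop :=
  forall (Y Z W : C) (f g : Hom (Y (x) Z) W),
    (forall eps : Hom P Y, f \o eps <x> idm Z = g \o eps <x> idm Z) -> f = g.

Definition right_coflat (C : StrictMonoidalCategory) (X : C) : Prop :=
  forall (Y Z Q : C) (f g : Hom Y Z) (q : Hom Z Q), is_coequalizer f g q ->
    is_coequalizer (idm X <x> f) (idm X <x> g) (idm X <x> q).

Definition left_coflat (C : StrictMonoidalCategory) (X : C) : Prop :=
  forall (Y Z Q : C) (f g : Hom Y Z) (q : Hom Z Q), is_coequalizer f g q ->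
    is_coequalizer (f <x> idm X) (g <x> idm X) (q <x> idm X).

(** * Algebras and modules *)

Record Algebra (C : StrictMonoidalCategory) := MkAlgebra {
  acar :> C;
  amul : Hom (acar (x) acar) acar;
  aone : Hom (tunit C) acar;
  amul_assoc : amul \o amul <x> idm acar =
    amul \o idm acar <x> amul \o asc acar acar acar;
  amul_1l : amul \o aone <x> idm acar = lun acar;
  amul_1r : amul \o idm acar <x> aone = run acar
}.

Arguments amul {C} a.
Arguments aone {C} a.

Record AlgebraMorphism (C : StrictMonoidalCategory) (R S : Algebra C) :=
  MkAlgebraMorphism {
  amap :> Hom (acar R) (acar S);
  amap_mul : amap \o amul R = amul S \o amap <x> amap;
  amap_one : amap \o aone R = aone S
}.

Record RightModule (C : StrictMonoidalCategory) (A : Algebra C) :=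
  MkRightModule {
  rcar :> C;
  ract : Hom (rcar (x) A) rcar;
  ract_assoc : ract \o ract <x> idm (acar A) =
    ract \o idm rcar <x> amul A \o asc rcar A A;
  ract_1 : ract \o idm rcar <x> aone A = run rcar
}.

Arguments ract {C A} r.

Record LeftModule (C : StrictMonoidalCategory) (A : Algebra C) :=
  MkLeftModule {
  lcar :> C;
  lact : Hom (A (x) lcar) lcar;
  lact_assoc : lact \o idm (acar A) <x> lact \o asc A A lcar =
    lact \o amul A <x> idm lcar;
  lact_1 : lact \o aone A <x> idm lcar = lun lcar
}.

Arguments lact {C A} l.

Record RightModuleHom (C : StrictMonoidalCategory) (A : Algebra C)
    (X Y : RightModule A) := MkRightModuleHom {
  rmap :> Hom (rcar X) (rcar Y);
  rmap_act : rmap \o ract X = ract Y \o rmap <x> idm (acar A)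
}.

Record Bimodule (C : StrictMonoidalCategory) (A : Algebra C) := MkBimodule {
  bcar :> C;
  blact : Hom (A (x) bcar) bcar;
  bract : Hom (bcar (x) A) bcar;
  blact_assoc : blact \o idm (acar A) <x> blact \o asc A A bcar =
    blact \o amul A <x> idm bcar;
  blact_1 : blact \o aone A <x> idm bcar = lun bcar;
  bract_assoc : bract \o bract <x> idm (acar A) =
    bract \o idm bcar <x> amul A \o asc bcar A A;
  bract_1 : bract \o idm bcar <x> aone A = run bcar;
  bact_comm : bract \o blact <x> idm (acar A) =
    blact \o idm (acar A) <x> bract \o asc A bcar A
}.

Arguments blact {C A} b.
Arguments bract {C A} b.

Record BimoduleHom (C : StrictMonoidalCategory) (A : Algebra C)
    (X Y : Bimodule A) := MkBimoduleHom {
  bmap :> Hom (bcar X) (bcar Y);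
  bmap_lact : bmap \o blact X = blact Y \o idm (acar A) <x> bmap;
  bmap_ract : bmap \o bract X = bract Y \o bmap <x> idm (acar A)
}.

Section ModuleCategory.
Variables (C : StrictMonoidalCategory) (A : Algebra C).

Lemma rmap_inj (X Y : RightModule A) (f g : RightModuleHom X Y) :
  rmap f = rmap g -> f = g.
Proof.
case: f g => f Hf [g Hg] /= e; case: g / e Hg => Hg.
by rewrite (proof_irrelevance _ Hf Hg).
Qed.

Lemma rmod_id_act (X : RightModule A) :
  idm (rcar X) \o ract X = ract X \o idm (rcar X) <x> idm (acar A).
Proof. by rewrite tensm_id comp_idl comp_idr. Qed.

Lemma rmod_comp_act (X Y Z : RightModule A) (g : RightModuleHom Y Z)
    (f : RightModuleHom X Y) :
  (g \o f) \o ract X = ract Z \o (g \o f) <x> idm (acar A).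
Proof.
by rewrite tensm_compl comp_assoc rmap_act -!comp_assoc rmap_act.
Qed.

Definition rmod_id (X : RightModule A) : RightModuleHom X X :=
  MkRightModuleHom (rmod_id_act X).

Definition rmod_comp (X Y Z : RightModule A) (g : RightModuleHom Y Z)
    (f : RightModuleHom X Y) : RightModuleHom X Z :=
  MkRightModuleHom (rmod_comp_act g f).

Lemma rmod_idl (X Y : RightModule A) (f : RightModuleHom X Y) :
  rmod_comp (rmod_id Y) f = f.
Proof. by apply: rmap_inj; rewrite /= comp_idl. Qed.

Lemma rmod_idr (X Y : RightModule A) (f : RightModuleHom X Y) :
  rmod_comp f (rmod_id X) = f.
Proof. by apply: rmap_inj; rewrite /= comp_idr. Qed.

Lemma rmod_assoc (X Y Z W : RightModule A) (h : RightModuleHom Z W)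
    (g : RightModuleHom Y Z) (f : RightModuleHom X Y) :
  rmod_comp (rmod_comp h g) f = rmod_comp h (rmod_comp g f).
Proof. by apply: rmap_inj; rewrite /= comp_assoc. Qed.

Definition RightModules : Category :=
  MkCategory rmod_idl rmod_idr rmod_assoc.

Definition regular_bimodule : Bimodule A :=
  MkBimodule (blact := amul A) (bract := amul A)
    (eq_sym (amul_assoc A)) (amul_1l A) (amul_assoc A) (amul_1r A)
    (amul_assoc A).

Definition regular_right : RightModule A :=
  MkRightModule (amul_assoc A) (amul_1r A).

Definition regular_left : LeftModule A :=
  MkLeftModule (eq_sym (amul_assoc A)) (amul_1l A).

End ModuleCategory.

Arguments regular_bimodule {C} A.
Arguments regular_right {C} A.
Arguments regular_left {C} A.

(** * Restriction of scalars *)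

Section Restriction.
Variables (C : StrictMonoidalCategory) (R S : Algebra C).
Variable i : AlgebraMorphism R S.

Lemma rrestr_assoc (M : C) (a : Hom (M (x) S) M) :
  a \o a <x> idm (acar S) = a \o idm M <x> amul S \o asc M S S ->
  (a \o idm M <x> i) \o (a \o idm M <x> i) <x> idm (acar R) =
  (a \o idm M <x> i) \o idm M <x> amul R \o asc M R R.
Proof.
move=> H.
rewrite tensm_compl !comp_assoc.
rewrite -(comp_assoc (idm M <x> i)) -tensm_swap !comp_assoc.
rewrite -(comp_assoc a) H !comp_assoc.
rewrite -tensm_comp comp_idl comp_idr asc_nat.
rewrite -(comp_assoc (idm M <x> amul S)) -tensm_compr.
by rewrite -(comp_assoc (idm M <x> i)) -tensm_compr amap_mul.
Qed.

Lemma rrestr_1 (M : C) (a : Hom (M (x) S) M) :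
  a \o idm M <x> aone S = run M ->
  (a \o idm M <x> i) \o idm M <x> aone R = run M.
Proof. by move=> H; rewrite comp_assoc -tensm_compr amap_one. Qed.

Lemma lrestr_assoc (M : C) (a : Hom (S (x) M) M) :
  a \o idm (acar S) <x> a \o asc S S M = a \o amul S <x> idm M ->
  (a \o i <x> idm M) \o idm (acar R) <x> (a \o i <x> idm M) \o asc R R M =
  (a \o i <x> idm M) \o amul R <x> idm M.
Proof.
move=> H.
rewrite (comp_assoc a _ (amul R <x> idm M)) -tensm_compl amap_mul tensm_compl.
rewrite -(comp_assoc a) -H !comp_assoc asc_nat.
rewrite -!(comp_assoc _ _ (asc R R M)).
rewrite -!tensm_comp !comp_idl.
by rewrite comp_idr.
Qed.

Lemma lrestr_1 (M : C) (a : Hom (S (x) M) M) :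
  a \o aone S <x> idm M = lun M ->
  (a \o i <x> idm M) \o aone R <x> idm M = lun M.
Proof. by move=> H; rewrite comp_assoc -tensm_compl amap_one. Qed.

Lemma restr_comm (M : C) (l : Hom (S (x) M) M) (r : Hom (M (x) S) M) :
  r \o l <x> idm (acar S) = l \o idm (acar S) <x> r \o asc S M S ->
  (r \o idm M <x> i) \o (l \o i <x> idm M) <x> idm (acar R) =
  (l \o i <x> idm M) \o idm (acar R) <x> (r \o idm M <x> i) \o asc R M R.
Proof.
move=> H.
rewrite tensm_compl !comp_assoc.
rewrite -(comp_assoc (idm M <x> i)) -tensm_swap !comp_assoc.
rewrite -(comp_assoc r) H !comp_assoc.
rewrite -tensm_comp comp_idl comp_idr asc_nat.
rewrite -!(comp_assoc _ _ (asc R M R)) -!tensm_comp.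
by rewrite !comp_idl comp_idr.
Qed.

Definition restrict_right (M : RightModule S) : RightModule R :=
  MkRightModule (rrestr_assoc (ract_assoc M)) (rrestr_1 (ract_1 M)).

Definition restrict_left (M : LeftModule S) : LeftModule R :=
  MkLeftModule (lrestr_assoc (lact_assoc M)) (lrestr_1 (lact_1 M)).

Definition restrict_bimodule (M : Bimodule S) : Bimodule R :=
  MkBimodule (lrestr_assoc (blact_assoc M)) (lrestr_1 (blact_1 M))
    (rrestr_assoc (bract_assoc M)) (rrestr_1 (bract_1 M))
    (restr_comm (bact_comm M)).

Lemma restrict_hom_act (X Y : RightModule S) (f : RightModuleHom X Y) :
  f \o ract (restrict_right X) = ract (restrict_right Y) \o f <x> idm (acar R).
Proof. by rewrite /= comp_assoc -tensm_swap -!comp_assoc rmap_act. Qed.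

Definition restrict_hom (X Y : RightModule S) (f : RightModuleHom X Y) :
    RightModuleHom (restrict_right X) (restrict_right Y) :=
  @MkRightModuleHom C R (restrict_right X) (restrict_right Y) f
    (restrict_hom_act f).

Lemma restrict_hom_id (X : RightModule S) :
  restrict_hom (rmod_id X) = rmod_id (restrict_right X).
Proof. exact: rmap_inj. Qed.

Lemma restrict_hom_comp (X Y Z : RightModule S) (g : RightModuleHom Y Z)
    (f : RightModuleHom X Y) :
  restrict_hom (rmod_comp g f) = rmod_comp (restrict_hom g) (restrict_hom f).
Proof. exact: rmap_inj. Qed.

Definition restriction : Functor (RightModules S) (RightModules R) :=
  @MkFunctor (RightModules S) (RightModules R) restrict_right restrict_hom
    restrict_hom_id restrict_hom_comp.

End Restriction.

(** * Tensor products over an algebra *)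

Section TensorOver.
Variables (C : StrictMonoidalCategory) (coeqs : Coequalizers C).
Variable R : Algebra C.

Definition tensR_coeq (X : RightModule R) (Y : LeftModule R) :=
  coeqs (ract X <x> idm (lcar Y)) (idm (rcar X) <x> lact Y \o asc X R Y).

Definition tensR (X : RightModule R) (Y : LeftModule R) : C :=
  coeq_obj (tensR_coeq X Y).

Definition tensR_q (X : RightModule R) (Y : LeftModule R) :
    Hom (X (x) Y) (tensR X Y) :=
  coeq_map (tensR_coeq X Y).

Lemma tensR_is (X : RightModule R) (Y : LeftModule R) :
  is_coequalizer (ract X <x> idm (lcar Y))
    (idm (rcar X) <x> lact Y \o asc X R Y) (tensR_q X Y).
Proof. exact: coeq_is. Qed.

Lemma tensR_qE (X : RightModule R) (Y : LeftModule R) :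
  tensR_q X Y \o ract X <x> idm (lcar Y) =
  tensR_q X Y \o (idm (rcar X) <x> lact Y \o asc X R Y).
Proof. exact: (proj1 (tensR_is X Y)). Qed.

End TensorOver.

(** * Induction *)

Section Induction.
Variables (C : StrictMonoidalCategory) (coeqs : Coequalizers C).
Variables (R S : Algebra C) (i : AlgebraMorphism R S).

(* [S] as a left and as a right [R]-module through [i] *)
Definition SlR : LeftModule R := restrict_left i (regular_left S).
Definition SrR : RightModule R := restrict_right i (regular_right S).

Notation q X := (tensR_q coeqs X SlR).

Lemma SlR_amul :
  amul S \o lact SlR <x> idm (acar S) =
  lact SlR \o idm (acar R) <x> amul S \o asc R S S.
Proof.
rewrite /= tensm_compl -comp_assoc amul_assoc !comp_assoc asc_nat tensm_id.
by rewrite -(comp_assoc (idm _ <x> _)) -tensm_swap !comp_assoc.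
Qed.

Section Action.
Variable X : RightModule R.

Lemma ind_act_wd :
  (q X \o idm (rcar X) <x> amul S \o asc X S S) \o
    (ract X <x> idm (acar S)) <x> idm (acar S) =
  (q X \o idm (rcar X) <x> amul S \o asc X S S) \o
    (idm (rcar X) <x> lact SlR \o asc X R S) <x> idm (acar S).
Proof.
rewrite tensm_compl !comp_assoc.
rewrite -!(comp_assoc (asc X S S)) !asc_nat !comp_assoc tensm_id.
rewrite -!(comp_assoc (idm (rcar X) <x> amul S)) -tensm_swap.
rewrite -tensm_compr SlR_amul 2!tensm_compr !comp_assoc.
rewrite -(comp_assoc (q X)) (tensR_qE coeqs X SlR) !comp_assoc.
rewrite -(comp_assoc (asc X R S)).
by rewrite -(tensm_id (rcar X)) asc_nat !comp_assoc pentagon.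
Qed.

Hypothesis hS : left_coflat (acar S).

Definition ind_act : Hom (tensR coeqs X SlR (x) S) (tensR coeqs X SlR) :=
  coeq_desc (hS (tensR_is coeqs X SlR)) ind_act_wd.

Lemma ind_actE :
  ind_act \o q X <x> idm (acar S) =
  q X \o idm (rcar X) <x> amul S \o asc X S S.
Proof. exact: coeq_descE. Qed.

Lemma ind_act_assoc :
  ind_act \o ind_act <x> idm (acar S) =
  ind_act \o idm (tensR coeqs X SlR) <x> amul S \o
    asc (tensR coeqs X SlR) S S.
Proof.
apply: (coeq_epi (hS (hS (tensR_is coeqs X SlR)))).
rewrite !comp_assoc -tensm_compl ind_actE asc_nat tensm_id.
rewrite -(comp_assoc (idm _ <x> amul S)) -tensm_swap !comp_assoc.
rewrite -(comp_assoc ind_act (q X <x> _)) ind_actE.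
rewrite 2!tensm_compl !comp_assoc.
rewrite -(comp_assoc ind_act (q X <x> _)) ind_actE !comp_assoc.
rewrite -(comp_assoc (asc X S S) (_ <x> _)) asc_nat !comp_assoc.
rewrite -(comp_assoc (idm _ <x> amul S)) -tensm_compr amul_assoc.
rewrite 2!tensm_compr !comp_assoc pentagon.
rewrite -(tensm_id (rcar X)).
by rewrite -(comp_assoc (asc X S S) (_ <x> _)) asc_nat !comp_assoc.
Qed.

Lemma ind_act_1 :
  ind_act \o idm (tensR coeqs X SlR) <x> aone S = run (tensR coeqs X SlR).
Proof.
have E : ind_act \o idm _ <x> aone S \o run_inv _ = idm _.
  apply: (coeq_epi (tensR_is coeqs X SlR)).
  rewrite !comp_assoc -run_inv_nat -(comp_assoc (idm _ <x> aone S)) -tensm_swap.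
  rewrite !comp_assoc -(comp_assoc ind_act) ind_actE !comp_assoc.
  rewrite -(tensm_id (rcar X)) -(comp_assoc (asc X S S)) asc_nat !comp_assoc.
  rewrite -(comp_assoc (idm _ <x> amul S)) -tensm_compr amul_1r.
  by rewrite -(comp_assoc (idm _ <x> run _)) triangle_r run_invK comp_idl comp_idr.
by rewrite -[LHS]comp_idr -(runK (tensR coeqs X SlR)) -comp_assoc E comp_idl.
Qed.

Definition ind_obj : RightModule S :=
  MkRightModule ind_act_assoc ind_act_1.

End Action.

Lemma ind_map_wd (X Y : RightModule R) (f : RightModuleHom X Y) :
  (q Y \o f <x> idm (acar S)) \o ract X <x> idm (acar S) =
  (q Y \o f <x> idm (acar S)) \o (idm (rcar X) <x> lact SlR \o asc X R S).
Proof.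
rewrite comp_assoc -tensm_compl rmap_act tensm_compl -comp_assoc.
rewrite (tensR_qE coeqs Y SlR) !comp_assoc asc_nat tensm_id.
by rewrite -(comp_assoc (idm _ <x> _)) -tensm_swap !comp_assoc.
Qed.

Definition ind_map (X Y : RightModule R) (f : RightModuleHom X Y) :
    Hom (tensR coeqs X SlR) (tensR coeqs Y SlR) :=
  coeq_desc (tensR_is coeqs X SlR) (ind_map_wd f).

Lemma ind_mapE (X Y : RightModule R) (f : RightModuleHom X Y) :
  ind_map f \o q X = q Y \o f <x> idm (acar S).
Proof. exact: coeq_descE. Qed.

Section InductionFunctor.
Hypothesis hS : left_coflat (acar S).

Lemma ind_map_act (X Y : RightModule R) (f : RightModuleHom X Y) :
  ind_map f \o ind_act X hS = ind_act Y hS \o ind_map f <x> idm (acar S).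
Proof.
apply: (coeq_epi (hS (tensR_is coeqs X SlR))).
rewrite !comp_assoc -tensm_compl ind_mapE ind_actE tensm_compl.
rewrite -!comp_assoc ind_mapE ind_actE !comp_assoc asc_nat tensm_id.
by rewrite -!(comp_assoc (_ <x> _)) tensm_swap.
Qed.

Definition ind_hom (X Y : RightModule R) (f : RightModuleHom X Y) :
    RightModuleHom (ind_obj X hS) (ind_obj Y hS) :=
  @MkRightModuleHom C S (ind_obj X hS) (ind_obj Y hS) (ind_map f)
    (ind_map_act f).

Lemma ind_hom_id (X : RightModule R) :
  ind_hom (rmod_id X) = rmod_id (ind_obj X hS).
Proof.
apply: rmap_inj; apply: (coeq_epi (tensR_is coeqs X SlR)).
by rewrite ind_mapE /= tensm_id comp_idl comp_idr.
Qed.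

Lemma ind_hom_comp (X Y Z : RightModule R) (g : RightModuleHom Y Z)
    (f : RightModuleHom X Y) :
  ind_hom (rmod_comp g f) = rmod_comp (ind_hom g) (ind_hom f).
Proof.
apply: rmap_inj; apply: (coeq_epi (tensR_is coeqs X SlR)).
by rewrite ind_mapE /= tensm_compl comp_assoc ind_mapE -!comp_assoc ind_mapE.
Qed.

Definition induction : Functor (RightModules R) (RightModules S) :=
  @MkFunctor (RightModules R) (RightModules S) (fun X => ind_obj X hS) ind_hom
    ind_hom_id ind_hom_comp.

End InductionFunctor.

(** * The [S]-actions and the multiplication on [S (x)_R S] *)

Definition SRS : C := tensR coeqs SrR SlR.
Definition SRS_q : Hom (S (x) S) SRS := q SrR.

Lemma SrR_amul :
  amul S \o idm (acar S) <x> ract SrR =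
  ract SrR \o amul S <x> idm (acar R) \o asc_inv S S R.
Proof.
rewrite -[LHS]comp_idr -(asc_invK S S R) -comp_assoc; congr (_ \o _).
rewrite /= tensm_compr !comp_assoc -asc_nat tensm_id -!comp_assoc -amul_assoc.
by rewrite !comp_assoc tensm_swap.
Qed.

Lemma SRS_lact_wd :
  (SRS_q \o amul S <x> idm (acar S) \o asc_inv S S S) \o
    idm (acar S) <x> (ract SrR <x> idm (acar S)) =
  (SRS_q \o amul S <x> idm (acar S) \o asc_inv S S S) \o
    idm (acar S) <x> (idm (acar S) <x> lact SlR \o asc S R S).
Proof.
rewrite tensm_compr !comp_assoc -!(comp_assoc (asc_inv S S S)).
rewrite !asc_inv_nat tensm_id !comp_assoc.
rewrite -!(comp_assoc (amul S <x> idm _)) -tensm_compl SrR_amul.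
rewrite 2!tensm_compl -pentagon_inv !comp_assoc.
rewrite -(comp_assoc SRS_q) (tensR_qE coeqs SrR SlR) !comp_assoc.
rewrite -(comp_assoc (asc S R S)) asc_nat !comp_assoc tensm_id.
by rewrite -!(comp_assoc (_ <x> _)) tensm_swap !comp_assoc.
Qed.

Definition SRS_lact (h : right_coflat (acar S)) : Hom (S (x) SRS) SRS :=
  coeq_desc (h _ _ _ _ _ _ (tensR_is coeqs SrR SlR)) SRS_lact_wd.

Lemma SRS_lactE (h : right_coflat (acar S)) :
  SRS_lact h \o idm (acar S) <x> SRS_q =
  SRS_q \o amul S <x> idm (acar S) \o asc_inv S S S.
Proof. exact: coeq_descE. Qed.

Definition SRS_ract (h : left_coflat (acar S)) : Hom (SRS (x) S) SRS :=
  ind_act SrR h.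

Lemma SRS_ractE (h : left_coflat (acar S)) :
  SRS_ract h \o SRS_q <x> idm (acar S) =
  SRS_q \o idm (acar S) <x> amul S \o asc S S S.
Proof. exact: (ind_actE SrR h). Qed.

Lemma SRS_mul_wd :
  amul S \o ract SrR <x> idm (acar S) =
  amul S \o (idm (acar S) <x> lact SlR \o asc S R S).
Proof.
rewrite /= tensm_compl -comp_assoc amul_assoc !comp_assoc asc_nat.
by rewrite tensm_compr !comp_assoc.
Qed.

Definition SRS_mul : Hom SRS S :=
  coeq_desc (tensR_is coeqs SrR SlR) SRS_mul_wd.

Lemma SRS_mulE : SRS_mul \o SRS_q = amul S.
Proof. exact: coeq_descE. Qed.

End Induction.

(* Main.v *)
(** (i) If [P] witnesses separability of restriction, apply it to
    [s |-> s (x) 1 : S -> S (x)_R S].  The result [sigma] is a right [S]-linear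
    section of the multiplication commuting with left multiplication by every
    [1 -> S]; as the unit object generates, it is left [S]-linear, and
    [e = sigma eta_S].  Conversely, [e] turns an [R]-linear [f] into the
    [S]-linear map [m |-> f(m e^1) e^2].

    (ii) If [P] witnesses separability of induction, apply it to
    [s (x) t |-> 1 (x) s t : S (x)_R S -> R (x)_R S] to get a right [R]-linear
    [theta : S -> R], left linear by the generator argument again.  Conversely,
    [theta] gives a natural retraction [x (x) s |-> x theta(s)] of the unit of
    the adjunction between induction and restriction. *)
From Stdlib Require Import ssreflect.
Require Import Defs.

Set Implicit Arguments.
Unset Strict Implicit.
Unset Printing Implicit Defensive.

(** * Coherence of the strict identifications *)

Section Coherence.
Variable C : StrictMonoidalCategory.

(** Composites nest to the left, so [a \o b] is not a subterm of [h \o a \o b]; this form lets an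
    equation about it be used there. *)
Lemma comp_post (X Y Z W : C) (a : Hom Y Z) (b : Hom X Y) (c : Hom X Z)
  (h : Hom Z W) : a \o b = c -> h \o a \o b = h \o c.
Proof. by move=> <-; rewrite comp_assoc. Qed.

Lemma lun_invK (X : C) : lun X \o lun_inv X = idm X.
Proof. exact: eqhom_symK. Qed.

Lemma lunK (X : C) : lun_inv X \o lun X = idm _.
Proof. exact: eqhomK. Qed.

Lemma lun_nat (X Y : C) (f : Hom X Y) :
  lun Y \o idm (tunit C) <x> f = f \o lun X.
Proof. exact: tensm1l. Qed.

Lemma run_nat (X Y : C) (f : Hom X Y) :
  run Y \o f <x> idm (tunit C) = f \o run X.
Proof. exact: tensm1r. Qed.

Lemma lun_inv_nat (X Y : C) (f : Hom X Y) :
  idm (tunit C) <x> f \o lun_inv X = lun_inv Y \o f.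
Proof.
rewrite -[LHS]comp_idl -(lunK Y) -!comp_assoc (comp_post _ (lun_nat f)).
by rewrite -comp_assoc (comp_post _ (lun_invK X)) comp_idr.
Qed.

(** Every structural map is the [eqhom] of an equality of objects, so each side collapses to a
    single [eqhom], and proof irrelevance identifies the two. *)
Ltac coherence :=
  rewrite /asc /asc_inv /lun /lun_inv /run /run_inv
    ?eqhom_tensr ?eqhom_tensl ?eqhom_comp; exact: eqhom_irr.

Lemma run_tunit_lun_inv : run (tunit C) \o lun_inv (tunit C) = idm _.
Proof. rewrite -run_invK; coherence. Qed.

Lemma asc_run_inv (X Y : C) :
  asc X Y (tunit C) \o run_inv (X (x) Y) = idm X <x> run_inv Y.
Proof. coherence. Qed.

Lemma asc_run_inv_tens (X Y : C) :
  asc X (tunit C) Y \o run_inv X <x> idm Y = idm X <x> lun_inv Y.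
Proof. coherence. Qed.

Lemma asc_lun_inv_tens (X Y : C) :
  asc (tunit C) X Y \o lun_inv X <x> idm Y = lun_inv (X (x) Y).
Proof. coherence. Qed.

Lemma asc_inv_lun_inv (X Y : C) :
  asc_inv (tunit C) X Y \o lun_inv (X (x) Y) = lun_inv X <x> idm Y.
Proof. coherence. Qed.

Lemma pentagon_lact (M X Y Z : C) :
  asc M X Y <x> idm Z \o asc_inv (M (x) X) Y Z =
  asc_inv M (X (x) Y) Z \o idm M <x> asc_inv X Y Z \o asc M X (Y (x) Z).
Proof. coherence. Qed.

Lemma pentagon_ract (M X Y Z : C) :
  asc (M (x) X) Y Z \o asc_inv M X Y <x> idm Z =
  asc_inv M X (Y (x) Z) \o idm M <x> asc X Y Z \o asc M (X (x) Y) Z.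
Proof. coherence. Qed.

Lemma asc_natr (X Y Z Z' : C) (h : Hom Z Z') :
  asc X Y Z' \o idm (X (x) Y) <x> h = idm X <x> (idm Y <x> h) \o asc X Y Z.
Proof. by rewrite -tensm_id asc_nat. Qed.

Lemma asc_natl (X X' Y Z : C) (f : Hom X X') :
  asc X' Y Z \o (f <x> idm Y) <x> idm Z = f <x> idm (Y (x) Z) \o asc X Y Z.
Proof. by rewrite asc_nat tensm_id. Qed.

Lemma asc_inv_natr (X Y Z Z' : C) (h : Hom Z Z') :
  asc_inv X Y Z' \o idm X <x> (idm Y <x> h) =
  idm (X (x) Y) <x> h \o asc_inv X Y Z.
Proof. by rewrite asc_inv_nat tensm_id. Qed.

Lemma asc_inv_natl (X X' Y Z : C) (f : Hom X X') :
  asc_inv X' Y Z \o f <x> idm (Y (x) Z) =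
  (f <x> idm Y) <x> idm Z \o asc_inv X Y Z.
Proof. by rewrite -tensm_id asc_inv_nat. Qed.

End Coherence.

(** * Left multiplication by elements of an algebra *)

Section LeftMultiplication.
Variables (C : StrictMonoidalCategory) (A : Algebra C).

Lemma amul_runK : amul A \o idm (acar A) <x> aone A \o run_inv A = idm _.
Proof. by rewrite amul_1r run_invK. Qed.

Lemma amul_lunK : amul A \o aone A <x> idm (acar A) \o lun_inv A = idm _.
Proof. by rewrite amul_1l lun_invK. Qed.

(** Being right [A]-linear, these maps are morphisms to which naturality of a separability map
    applies. Commutation with all of them is upgraded to left linearity when the unit object
    generates. *)
Definition lmul (eps : Hom (tunit C) A) : Hom A A :=
  amul A \o eps <x> idm (acar A) \o lun_inv A.

Lemma lmul_amul (eps : Hom (tunit C) A) :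
  lmul eps \o amul A = amul A \o lmul eps <x> idm (acar A).
Proof.
rewrite /lmul !tensm_compl -!comp_assoc amul_assoc.
rewrite (comp_post _ (asc_natl _ _ _)) -!comp_assoc.
rewrite (comp_post _ (asc_lun_inv_tens _ _)).
rewrite (comp_post _ (eq_sym (tensm_swap eps (amul A)))) -!comp_assoc.
by rewrite (comp_post _ (lun_inv_nat _)) -!comp_assoc.
Qed.

Definition lmul_hom (eps : Hom (tunit C) A) :
    RightModuleHom (regular_right A) (regular_right A) :=
  @MkRightModuleHom C A (regular_right A) (regular_right A) (lmul eps)
    (lmul_amul eps).

Lemma lmul_lun (eps : Hom (tunit C) A) :
  lmul eps \o lun A = amul A \o eps <x> idm (acar A).
Proof. by rewrite /lmul (comp_post _ (lunK _)) comp_idr. Qed.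

Lemma lmul_aone (eps : Hom (tunit C) A) : lmul eps \o aone A = eps.
Proof.
rewrite /lmul (comp_post _ (eq_sym (lun_inv_nat _))) -!comp_assoc.
rewrite (comp_post _ (tensm_swap _ _)) -!comp_assoc amul_1r run_nat.
by rewrite (comp_post _ (run_tunit_lun_inv C)) comp_idr.
Qed.

End LeftMultiplication.

(** * Unit and counit of the adjunction between induction and restriction *)

Section InductionRestriction.
Variables (C : StrictMonoidalCategory) (coeqs : Coequalizers C).
Variables (R S : Algebra C) (i : AlgebraMorphism R S).
Hypothesis hS : left_coflat (acar S).

Notation SlR := (SlR i).
Notation SrR := (SrR i).
Notation SRS := (SRS coeqs i).
Notation q X := (tensR_q coeqs X SlR).
Notation ind X := (ind_obj coeqs i X hS).

(** The unit x |-> x (x) 1 of the adjunction. *)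
Definition unit_map (X : RightModule R) : Hom X (tensR coeqs X SlR) :=
  q X \o idm (rcar X) <x> aone S \o run_inv X.

(** Balancing over [R] gives xr (x) 1 = x (x) r1 = x (x) i(r). *)
Lemma unit_map_ract (X : RightModule R) :
  unit_map X \o ract X = q X \o idm (rcar X) <x> i.
Proof.
rewrite /unit_map (comp_post _ (eq_sym (run_inv_nat _))) -!comp_assoc.
rewrite (comp_post _ (eq_sym (tensm_swap _ _))) -!comp_assoc.
rewrite (tensR_qE coeqs X SlR) -!comp_assoc.
rewrite (comp_post _ (asc_natr _ _ _)) -!comp_assoc.
rewrite (comp_post _ (asc_run_inv _ _)) !(comp_post _ (eq_sym (tensm_compr _ _ _))).
congr (_ \o _ <x> _).
rewrite /= -!comp_assoc (comp_post _ (tensm_swap _ _)) -!comp_assoc.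
by rewrite (comp_post _ (run_inv_nat _)) -comp_assoc amul_runK comp_idl.
Qed.

Lemma ind_act_unit_map (X : RightModule R) :
  ind_act coeqs i X hS \o unit_map X <x> idm (acar S) = q X.
Proof.
rewrite /unit_map !tensm_compl -!comp_assoc ind_actE.
rewrite (comp_post _ (asc_nat _ _ _)) -!comp_assoc.
rewrite (comp_post _ (asc_run_inv_tens _ _)).
rewrite !(comp_post _ (eq_sym (tensm_compr _ _ _))) -!(comp_assoc (amul S)) amul_lunK.
by rewrite tensm_id comp_idr.
Qed.

Lemma unit_act (X : RightModule R) :
  unit_map X \o ract X =
  ract (restrict_right i (ind X)) \o unit_map X <x> idm (acar R).
Proof.
rewrite unit_map_ract /= (comp_post _ (eq_sym (tensm_swap _ _))) -!comp_assoc.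
by rewrite ind_act_unit_map.
Qed.

Definition unit_hom (X : RightModule R) :
    RightModuleHom X (restrict_right i (ind X)) :=
  @MkRightModuleHom C R X (restrict_right i (ind X)) _ (unit_act X).

Lemma unit_map_nat (X Y : RightModule R) (f : RightModuleHom X Y) :
  ind_map coeqs i f \o unit_map X = unit_map Y \o f.
Proof.
rewrite /unit_map -!comp_assoc ind_mapE (comp_post _ (tensm_swap _ _)).
by rewrite -!comp_assoc (comp_post _ (run_inv_nat _)) -comp_assoc.
Qed.

Lemma SRS_mul_act :
  SRS_mul coeqs i \o ract (ind SrR) =
  amul S \o SRS_mul coeqs i <x> idm (acar S).
Proof.
apply: (coeq_epi (hS (tensR_is coeqs SrR SlR))).
rewrite (comp_post _ (eq_sym (tensm_compl _ _ _))) (SRS_mulE coeqs i).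
rewrite (comp_post _ (ind_actE coeqs i SrR hS)) -!comp_assoc (SRS_mulE coeqs i).
by rewrite amul_assoc.
Qed.

(** The counit of the adjunction at the regular module [S]. *)
Definition SRS_mul_hom : RightModuleHom (ind SrR) (regular_right S) :=
  @MkRightModuleHom C S (ind SrR) (regular_right S) _ SRS_mul_act.

Lemma SRS_mul_unit_map : SRS_mul coeqs i \o unit_map SrR = idm _.
Proof. by rewrite /unit_map -!comp_assoc (SRS_mulE coeqs i) amul_runK. Qed.

(** * Restriction of scalars and central elements of S (x)_R S *)

Section RestrictionSeparable.
Hypothesis hr : forall X : C, right_coflat X.
Notation lactS := (SRS_lact coeqs i (hr (acar S))).
Notation ractS := (SRS_ract coeqs i hS).

(** Links the left action on S (x)_R S, which is not part of its structure in the category of right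
    modules, to maps that are morphisms there. *)
Lemma SRS_lact_lmul (eps : Hom (tunit C) S) :
  lactS \o eps <x> idm SRS \o lun_inv SRS =
  ind_map coeqs i (restrict_hom i (lmul_hom eps)).
Proof.
apply: (coeq_epi (tensR_is coeqs SrR SlR)).
rewrite ind_mapE (comp_post _ (eq_sym (lun_inv_nat _))) -!comp_assoc.
rewrite (comp_post _ (tensm_swap _ _)) -!comp_assoc.
rewrite (SRS_lactE coeqs i (hr (acar S))).
rewrite (comp_post _ (asc_inv_natl _ _ _)) -!comp_assoc.
rewrite (comp_post _ (asc_inv_lun_inv _ _)).
by rewrite !comp_assoc -!tensm_compl -!comp_assoc.
Qed.

Lemma casimir_of_separable (hgen : left_tensor_generator (tunit C)) :
  separable (restriction i) ->
  exists e : Hom (tunit C) SRS,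
    lactS \o idm (acar S) <x> e \o run_inv (acar S) =
      ractS \o e <x> idm (acar S) \o lun_inv (acar S) /\
    SRS_mul coeqs i \o e = aone S.
Proof.
case=> P [PF Pnat].
pose sigma : RightModuleHom (regular_right S) (ind SrR) :=
  P (regular_right S) (ind SrR) (unit_hom SrR).
have mul_sigma : SRS_mul coeqs i \o sigma = idm _.
  (* Naturality of [P] for the square with [unit_hom] and an identity, along the [S]-linear
     multiplication; the square commutes because multiplication retracts the unit map. *)
  have E : P _ _ (fmap (restriction i) (idm (regular_right S : RightModules S)))
      \o idm _ =
      rmod_comp SRS_mul_hom sigma.
    apply: Pnat; apply: rmap_inj; rewrite /= comp_idl.
    exact: (eq_sym SRS_mul_unit_map).
  by move: E; rewrite PF comp_idl => /(f_equal (@rmap _ _ _ _)) /= <-.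
have sigma_lmul eps : sigma \o lmul eps =
    ind_map coeqs i (restrict_hom i (lmul_hom eps)) \o sigma.
  apply: (f_equal (@rmap _ _ _ _) (Pnat _ _ _ _ (lmul_hom eps)
    (ind_hom coeqs i hS (restrict_hom i (lmul_hom eps)))
    (unit_hom SrR) (unit_hom SrR) _)).
  apply: rmap_inj; exact: (eq_sym (unit_map_nat (restrict_hom i (lmul_hom eps)))).
have sigma_lact : sigma \o amul S = lactS \o idm (acar S) <x> sigma.
  (* Tested on an element [eps] of [S], left linearity becomes [sigma_lmul]. *)
  apply: hgen => eps.
  rewrite comp_assoc -lmul_lun -comp_assoc sigma_lmul -SRS_lact_lmul.
  rewrite (comp_post _ (eq_sym (lun_inv_nat _))) -!comp_assoc.
  rewrite (comp_post _ (lunK _)) comp_idr (comp_post _ (tensm_swap _ _)).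
  by rewrite -comp_assoc.
have sigma_ract : sigma \o amul S = ractS \o sigma <x> idm (acar S).
  exact: (rmap_act sigma).
exists (sigma \o aone S); split; last by rewrite -comp_assoc mul_sigma comp_idl.
(* By two-sided linearity, s e = sigma(s 1) and e s = sigma(1 s), so both sides equal [sigma]. *)
rewrite tensm_compl tensm_compr -!comp_assoc -sigma_ract -sigma_lact.
by rewrite !(comp_assoc sigma) amul_runK amul_lunK.
Qed.

(** * The map m (x) s (x) t |-> f(ms)t and its evaluation at e *)

Section CasimirMap.
Variables (M N : RightModule S).
Variable f : RightModuleHom (restrict_right i M) (restrict_right i N).

(** Balanced because [f] is [R]-linear: f(m(sr))t = (f(ms)i(r))t = f(ms)(i(r)t). *)
Lemma casimir_map_wd :
  (ract N \o (f \o ract M) <x> idm (acar S) \o asc_inv M S S) \o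
    idm (rcar M) <x> (ract SrR <x> idm (acar S)) =
  (ract N \o (f \o ract M) <x> idm (acar S) \o asc_inv M S S) \o
    idm (rcar M) <x> (idm (acar S) <x> lact SlR \o asc S R S).
Proof.
have fR : (f \o ract M) \o idm (rcar M) <x> ract SrR =
    ract N \o idm (rcar N) <x> i \o (f \o ract M) <x> idm (acar R) \o asc_inv M S R.
  have fi : f \o (ract M \o idm (rcar M) <x> i) =
      ract N \o idm (rcar N) <x> i \o f <x> idm (acar R) := rmap_act f.
  rewrite tensm_compl -!comp_assoc -fi.
  rewrite !comp_assoc -!(comp_assoc (idm _ <x> i)) -tensm_swap.
  rewrite -!(comp_assoc (ract M)) ract_assoc /= tensm_compr.
  rewrite -!comp_assoc (comp_post _ (asc_natr _ _ _)) -!comp_assoc.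
  by rewrite (comp_post _ (asc_invK _ _ _)) comp_idr.
rewrite (comp_post _ (asc_inv_nat _ _ _)) -!comp_assoc.
rewrite (comp_post _ (eq_sym (tensm_compl _ _ _))) fR !tensm_compl -!comp_assoc.
rewrite ract_assoc (comp_post _ (asc_nat _ _ _)) -!comp_assoc.
rewrite !(comp_post _ (asc_natl _ _ _)) -!comp_assoc.
rewrite (comp_post _ (asc_natl _ _ _)) -!comp_assoc.
rewrite (comp_post _ (pentagon_ract _ _ _ _)) -!comp_assoc.
rewrite (comp_post _ (asc_invK _ _ _)) comp_idr.
rewrite [in RHS]tensm_compr -!comp_assoc (comp_post _ (asc_inv_natr _ _ _)).
rewrite -!comp_assoc !(comp_post _ (tensm_swap _ (lact SlR))) -!comp_assoc.
rewrite (comp_post _ (tensm_swap _ (lact SlR))) -!comp_assoc.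
by rewrite /= tensm_compr -!comp_assoc.
Qed.

(** Right coflatness of [M] makes M (x) (S (x)_R S) a coequalizer, so the balanced map descends. *)
Definition casimir_map : Hom (M (x) SRS) N :=
  coeq_desc (hr M (tensR_is coeqs SrR SlR)) casimir_map_wd.

Lemma casimir_mapE :
  casimir_map \o idm (rcar M) <x> SRS_q coeqs i =
  ract N \o (f \o ract M) <x> idm (acar S) \o asc_inv M S S.
Proof. exact: coeq_descE. Qed.

(** Associativity of the action on [M]: f((ms')s)t = f(m(s's))t. *)
Lemma casimir_map_lact :
  casimir_map \o ract M <x> idm SRS =
  casimir_map \o idm (rcar M) <x> lactS \o asc M S SRS.
Proof.
apply: (coeq_epi (hr (M (x) S) (tensR_is coeqs SrR SlR))).
rewrite -/(SRS_q coeqs i) (comp_post _ (tensm_swap _ _)) -!comp_assoc casimir_mapE.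
rewrite (comp_post _ (asc_inv_natl _ _ _)) -!comp_assoc.
rewrite (comp_post _ (eq_sym (tensm_compl _ _ _))) (comp_assoc f) ract_assoc.
rewrite (comp_post _ (asc_natr _ _ _)) -!comp_assoc.
rewrite (comp_post _ (eq_sym (tensm_compr _ _ _))) (SRS_lactE coeqs i (hr (acar S))).
rewrite 2!tensm_compr -!comp_assoc casimir_mapE.
rewrite (comp_post _ (asc_inv_nat _ _ _)) !tensm_compl -!comp_assoc.
by rewrite (comp_post _ (pentagon_lact _ _ _ _)) -!comp_assoc.
Qed.

(** Associativity of the action on [N]: (f(ms)t)t' = f(ms)(tt'). *)
Lemma casimir_map_ract :
  ract N \o casimir_map <x> idm (acar S) =
  casimir_map \o idm (rcar M) <x> ractS \o asc M SRS S.
Proof.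
apply: (coeq_epi (hS (hr M (tensR_is coeqs SrR SlR)))).
rewrite -/(SRS_q coeqs i) (comp_post _ (eq_sym (tensm_compl _ _ _))) casimir_mapE.
rewrite (comp_post _ (asc_nat _ _ _)) -!comp_assoc.
rewrite (comp_post _ (eq_sym (tensm_compr _ _ _))) (SRS_ractE coeqs i hS).
rewrite 2!tensm_compr -!comp_assoc casimir_mapE.
rewrite (comp_post _ (asc_inv_natr _ _ _)) -!comp_assoc.
rewrite (tensm_compl _ _ (asc_inv _ _ _)) (tensm_compl _ (ract N)) -!comp_assoc.
rewrite ract_assoc (comp_post _ (asc_natl _ _ _)) -!comp_assoc.
rewrite (comp_post _ (eq_sym (tensm_swap _ _))) -!comp_assoc.
by rewrite (comp_post _ (pentagon_ract _ _ _ _)) -!comp_assoc.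
Qed.

Variable e : Hom (tunit C) SRS.
Hypothesis e_central : lactS \o idm (acar S) <x> e \o run_inv (acar S) =
  ractS \o e <x> idm (acar S) \o lun_inv (acar S).

Definition casimir_lift : Hom M N :=
  casimir_map \o idm (rcar M) <x> e \o run_inv M.

(** Centrality replaces (ms)e by m(se) = m(es), and [casimir_map_ract] pulls the last s out. *)
Lemma casimir_lift_act :
  casimir_lift \o ract M = ract N \o casimir_lift <x> idm (acar S).
Proof.
rewrite /casimir_lift (comp_post _ (eq_sym (run_inv_nat _))) -!comp_assoc.
rewrite (comp_post _ (eq_sym (tensm_swap _ _))) -!comp_assoc casimir_map_lact.
rewrite (comp_post _ (asc_natr _ _ _)) -!comp_assoc.
rewrite (comp_post _ (asc_run_inv _ _)) !(comp_post _ (eq_sym (tensm_compr _ _ _))).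
rewrite -!(comp_assoc lactS) e_central.
rewrite !tensm_compl -!comp_assoc casimir_map_ract.
rewrite (comp_post _ (asc_nat _ _ _)) -!comp_assoc.
rewrite (comp_post _ (asc_run_inv_tens _ _)).
by rewrite !(comp_post _ (eq_sym (tensm_compr _ _ _))) -!comp_assoc.
Qed.

Definition casimir_hom : RightModuleHom M N := MkRightModuleHom casimir_lift_act.

End CasimirMap.

(** For [S]-linear [f], f(ms)t = f(m(st)). Evaluating at [e], whose product is 1, then returns [f]:
    this gives the retraction property of the separability map. *)
Lemma casimir_map_restrict (M N : RightModule S) (f : RightModuleHom M N) :
  casimir_map (restrict_hom i f) =
  f \o (ract M \o idm (rcar M) <x> SRS_mul coeqs i).
Proof.
apply: (coeq_epi (hr M (tensR_is coeqs SrR SlR))).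
rewrite -/(SRS_q coeqs i) casimir_mapE /=.
rewrite !comp_assoc -tensm_compr (SRS_mulE coeqs i).
rewrite tensm_compl -!comp_assoc -(rmap_act f).
rewrite (comp_post _ (ract_assoc M)) -!comp_assoc.
by rewrite (comp_post _ (asc_invK _ _ _)) comp_idr.
Qed.

Lemma casimir_map_nat (M M' N N' : RightModule S)
    (g : RightModuleHom (restrict_right i M) (restrict_right i M'))
    (h : RightModuleHom (restrict_right i N) (restrict_right i N'))
    (f : RightModuleHom M N) (f' : RightModuleHom M' N') :
  h \o f = f' \o g ->
  casimir_map h \o f <x> idm SRS = f' \o casimir_map g.
Proof.
move=> e.
apply: (coeq_epi (hr M (tensR_is coeqs SrR SlR))).
rewrite -/(SRS_q coeqs i) (comp_post _ (tensm_swap _ _)).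
rewrite (comp_post _ (casimir_mapE g)) -!comp_assoc casimir_mapE.
rewrite (comp_post _ (asc_inv_natl _ _ _)) -!comp_assoc.
rewrite (comp_post _ (eq_sym (tensm_compl _ _ _))) (comp_assoc h).
rewrite -(rmap_act f) -comp_assoc e !tensm_compl -!comp_assoc.
by rewrite -(rmap_act f').
Qed.

Lemma separable_of_casimir (e : Hom (tunit C) SRS) :
  lactS \o idm (acar S) <x> e \o run_inv (acar S) =
    ractS \o e <x> idm (acar S) \o lun_inv (acar S) ->
  SRS_mul coeqs i \o e = aone S ->
  separable (restriction i).
Proof.
move=> e_central e_split.
exists (fun (M N : RightModules S) f => casimir_hom f e_central); split.
  move=> M N f; apply: rmap_inj; rewrite /= /casimir_lift casimir_map_restrict.
  rewrite -!comp_assoc (comp_post _ (eq_sym (tensm_compr _ _ _))) e_split.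
  by rewrite (comp_post _ (ract_1 M)) (comp_post _ (run_invK _)) comp_idr.
move=> M M' N N' f f' g h /(f_equal (@rmap _ _ _ _)) /= E; apply: rmap_inj.
rewrite /= /casimir_lift (comp_post _ (eq_sym (run_inv_nat _))) -!comp_assoc.
rewrite (comp_post _ (eq_sym (tensm_swap _ _))) -!comp_assoc.
by rewrite (casimir_map_nat E).
Qed.

End RestrictionSeparable.

(** * Induction: from separability to a bimodule splitting of i *)

Section InductionSeparable.
Notation RR := (regular_right R).

(** The map s |-> 1 (x) s, inverse to the canonical isomorphism from R (x)_R S to S. *)
Definition ind_unit : Hom S (tensR coeqs RR SlR) :=
  q RR \o aone R <x> idm (acar S) \o lun_inv S.

Lemma ind_unit_act : ind_unit \o amul S = ract (ind RR) \o ind_unit <x> idm (acar S).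
Proof.
rewrite /ind_unit /= !tensm_compl -!comp_assoc (ind_actE coeqs i RR hS).
rewrite (comp_post _ (asc_natl _ _ _)) -!comp_assoc.
rewrite (comp_post _ (asc_lun_inv_tens _ _)).
rewrite (comp_post _ (eq_sym (tensm_swap _ _))) -!comp_assoc.
by rewrite (comp_post _ (lun_inv_nat _)) -!comp_assoc.
Qed.

Definition ind_unit_hom : RightModuleHom (regular_right S) (ind RR) :=
  @MkRightModuleHom C S (regular_right S) (ind RR) _ ind_unit_act.

(** Balancing gives 1 (x) i(r)s = 1r (x) s = r (x) s. *)
Lemma ind_unit_lact : ind_unit \o lact SlR = q RR.
Proof.
rewrite /ind_unit (comp_post _ (eq_sym (lun_inv_nat _))) -!comp_assoc.
rewrite (comp_post _ (tensm_swap _ _)) -!comp_assoc.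
have -> : q RR \o idm (acar R) <x> lact SlR =
    q RR \o amul R <x> idm (acar S) \o asc_inv R R S.
  rewrite (tensR_qE coeqs RR SlR) -!comp_assoc.
  by rewrite (comp_post _ (asc_invK _ _ _)) comp_idr.
rewrite (comp_post _ (asc_inv_natl _ _ _)) -!comp_assoc.
rewrite (comp_post _ (asc_inv_lun_inv _ _)).
rewrite !(comp_post _ (eq_sym (tensm_compl _ _ _))) -!(comp_assoc (amul R)).
by rewrite amul_lunK tensm_id comp_idr.
Qed.

Lemma ind_unit_lmul (eps : Hom (tunit C) R) :
  ind_unit \o lmul (i \o eps) = ind_map coeqs i (lmul_hom eps) \o ind_unit.
Proof.
rewrite {2}/ind_unit -!comp_assoc ind_mapE.
rewrite (comp_post _ (eq_sym (tensm_compl _ _ _))) lmul_aone.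
rewrite /lmul tensm_compl -!comp_assoc.
by rewrite (comp_assoc _ (amul S)) ind_unit_lact.
Qed.

Lemma amap_act : i \o amul R = ract SrR \o i <x> idm (acar R).
Proof. by rewrite amap_mul /= comp_assoc -tensm_comp comp_idl comp_idr. Qed.

Definition amap_hom : RightModuleHom RR SrR :=
  @MkRightModuleHom C R RR SrR _ amap_act.

(** The composite r (x) s |-> i(r) (x) s |-> 1 (x) i(r)s is the identity by balancing; naturality of
    [P] along [i] will turn this into theta i = id. *)
Lemma ind_unit_SRS_mul_amap :
  ind_unit \o SRS_mul coeqs i \o ind_map coeqs i amap_hom = idm _.
Proof.
apply: (coeq_epi (tensR_is coeqs RR SlR)).
rewrite (comp_post _ (ind_mapE coeqs i amap_hom)) -!comp_assoc.
rewrite (comp_post _ (SRS_mulE coeqs i)) comp_idl comp_assoc.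
exact: ind_unit_lact.
Qed.

(** Supplies the commuting square from which naturality of [P] makes [theta] commute with left
    multiplication by elements of [R]. *)
Lemma ind_unit_SRS_mul_lmul (eps : Hom (tunit C) R) :
  ind_unit \o SRS_mul coeqs i \o
    ind_map coeqs i (restrict_hom i (lmul_hom (i \o eps))) =
  ind_map coeqs i (lmul_hom eps) \o (ind_unit \o SRS_mul coeqs i).
Proof.
apply: (coeq_epi (tensR_is coeqs SrR SlR)).
rewrite (comp_post _ (ind_mapE coeqs i (restrict_hom i (lmul_hom (i \o eps))))).
rewrite -(comp_assoc (ind_map _ _ _)) -ind_unit_lmul.
rewrite -(comp_assoc _ (tensR_q _ _ _)) !(comp_post _ (SRS_mulE coeqs i)).
by rewrite !(comp_assoc ind_unit) lmul_amul.
Qed.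

Lemma splitting_of_separable (hgen : left_tensor_generator (tunit C)) :
  separable (induction coeqs i hS) ->
  exists theta : BimoduleHom (restrict_bimodule i (regular_bimodule S))
                             (regular_bimodule R),
    bmap theta \o aone S = aone R.
Proof.
case=> P [PF Pnat].
pose mu : RightModuleHom (ind SrR) (ind RR) := rmod_comp ind_unit_hom SRS_mul_hom.
pose theta : RightModuleHom SrR RR := P SrR RR mu.
have theta_i : theta \o i = idm _.
  have E : (theta : @Hom (RightModules R) SrR RR) \o amap_hom =
      idm (RR : RightModules R) \o
      P _ _ (fmap (induction coeqs i hS) (idm (RR : RightModules R))).
    apply: Pnat; apply: rmap_inj; rewrite !fmap_id comp_idl.
    exact: ind_unit_SRS_mul_amap.
  by move: E; rewrite PF comp_idl => /(f_equal (@rmap _ _ _ _)).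
have theta_lmul eps : theta \o lmul (i \o eps) = lmul eps \o theta.
  apply: (f_equal (@rmap _ _ _ _) (Pnat SrR RR SrR RR
    (restrict_hom i (lmul_hom (i \o eps))) (lmul_hom eps) mu mu _)).
  apply: rmap_inj; exact: ind_unit_SRS_mul_lmul.
have theta_lact : theta \o (amul S \o i <x> idm (acar S)) =
    amul R \o idm (acar R) <x> theta.
  (* Here [eps] is an element of [R], and left [R]-linearity at [eps] is [theta_lmul]. *)
  apply: hgen => eps.
  rewrite !comp_assoc -tensm_compl -lmul_lun -(comp_assoc theta) theta_lmul.
  by rewrite comp_assoc -lun_nat -comp_assoc lmul_lun comp_assoc tensm_swap.
have theta_ract : theta \o (amul S \o idm (acar S) <x> i) =
    amul R \o theta <x> idm (acar R) := rmap_act theta.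
exists (@MkBimoduleHom C R (restrict_bimodule i (regular_bimodule S))
  (regular_bimodule R) theta theta_lact theta_ract).
by rewrite /= -(amap_one i) -comp_assoc theta_i comp_idl.
Qed.

(** * Induction: from a bimodule splitting to separability *)

Section Splitting.
Variable theta : BimoduleHom (restrict_bimodule i (regular_bimodule S))
  (regular_bimodule R).
Hypothesis theta_1 : bmap theta \o aone S = aone R.

(** Right [R]-linearity gives theta(i(r)) = theta(1 i(r)) = theta(1)r = r. *)
Lemma splitting_retract : bmap theta \o i = idm _.
Proof.
have theta_ract : theta \o (amul S \o idm (acar S) <x> i) =
    amul R \o theta <x> idm (acar R) := bmap_ract theta.
have {1}-> : amap i =
    amul S \o idm (acar S) <x> i \o aone S <x> idm (acar R) \o lun_inv R.
  rewrite (comp_post _ (eq_sym (tensm_swap _ _))) -!comp_assoc.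
  rewrite (comp_post _ (lun_inv_nat _)).
  by rewrite -comp_assoc amul_lunK comp_idl.
rewrite -!comp_assoc (comp_assoc (bmap theta)) theta_ract.
by rewrite (comp_post _ (eq_sym (tensm_compl _ _ _))) theta_1 amul_lunK.
Qed.

(* [R] is not assumed left coflat, but it is a retract of [S], which is. *)
Lemma coeq_epi_tensl (X Y Q Z : C) (f g : Hom X Y) (p : Hom Y Q)
    (k1 k2 : Hom (Q (x) R) Z) : is_coequalizer f g p ->
  k1 \o p <x> idm (acar R) = k2 \o p <x> idm (acar R) -> k1 = k2.
Proof.
move=> hp E.
have E' : k1 \o idm Q <x> theta = k2 \o idm Q <x> theta.
  apply: (coeq_epi (hS hp)).
  by rewrite !comp_assoc -!tensm_swap -!comp_assoc E.
rewrite -[k1]comp_idr -[k2]comp_idr -(tensm_id Q) -splitting_retract tensm_compr.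
by rewrite -!comp_assoc E'.
Qed.

Section Counit.
Variable X : RightModule R.

(** Left [R]-linearity of [theta]: (xr)theta(s) = x(r theta(s)) = x theta(i(r)s). *)
Lemma split_map_wd :
  (ract X \o idm (rcar X) <x> theta) \o ract X <x> idm (acar S) =
  (ract X \o idm (rcar X) <x> theta) \o
    (idm (rcar X) <x> lact SlR \o asc X R S).
Proof.
have theta_lact : theta \o lact SlR = amul R \o idm (acar R) <x> theta :=
  bmap_lact theta.
rewrite -!comp_assoc (comp_post _ (eq_sym (tensm_swap _ _))) -!comp_assoc.
rewrite (comp_post _ (eq_sym (tensm_compr _ _ _))) theta_lact ract_assoc.
by rewrite (comp_post _ (asc_natr _ _ _)) tensm_compr -!comp_assoc.
Qed.

Definition split_map : Hom (tensR coeqs X SlR) X :=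
  coeq_desc (tensR_is coeqs X SlR) split_map_wd.

Lemma split_mapE : split_map \o q X = ract X \o idm (rcar X) <x> theta.
Proof. exact: coeq_descE. Qed.

(** Right [R]-linearity of [theta]: x theta(s i(r)) = (x theta(s))r. Checking this on
    representatives needs q (x) R to be epi, hence [coeq_epi_tensl]. *)
Lemma split_map_act :
  split_map \o ract (restrict_right i (ind X)) =
  ract X \o split_map <x> idm (acar R).
Proof.
have theta_ract : theta \o (amul S \o idm (acar S) <x> i) =
    amul R \o theta <x> idm (acar R) := bmap_ract theta.
apply: (coeq_epi_tensl (tensR_is coeqs X SlR)).
rewrite /= (comp_post _ (eq_sym (tensm_compl _ _ _))) split_mapE.
rewrite -!comp_assoc (comp_post _ (eq_sym (tensm_swap _ _))) -!comp_assoc.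
rewrite (comp_post _ (ind_actE coeqs i X hS)) -!comp_assoc split_mapE.
rewrite (comp_post _ (asc_natr _ _ _)) -!comp_assoc.
rewrite !(comp_post _ (eq_sym (tensm_compr _ _ _))) comp_assoc theta_ract.
rewrite tensm_compl -!comp_assoc ract_assoc (comp_post _ (asc_nat _ _ _)).
by rewrite tensm_compr -!comp_assoc.
Qed.

Definition split_hom : RightModuleHom (restrict_right i (ind X)) X :=
  @MkRightModuleHom C R (restrict_right i (ind X)) X _ split_map_act.

Lemma split_unit_map : split_map \o unit_map X = idm _.
Proof.
rewrite /unit_map -!comp_assoc split_mapE (comp_post _ (eq_sym (tensm_compr _ _ _))).
by rewrite theta_1 ract_1 run_invK.
Qed.

End Counit.

Lemma split_map_nat (X Y : RightModule R) (f : RightModuleHom X Y) :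
  split_map Y \o ind_map coeqs i f = f \o split_map X.
Proof.
apply: (coeq_epi (tensR_is coeqs X SlR)).
rewrite !comp_assoc split_mapE ind_mapE -!comp_assoc split_mapE.
by rewrite (rmap_act f) (comp_post _ (eq_sym (tensm_swap _ _))) -!comp_assoc.
Qed.

(** Rafael's criterion: with a natural retraction of the unit, [g] is sent to its adjoint transpose
    followed by the retraction, and naturality of unit and retraction gives both axioms. *)
Lemma separable_of_splitting : separable (induction coeqs i hS).
Proof.
exists (fun (X Y : RightModules R) g =>
  rmod_comp (split_hom Y) (rmod_comp (restrict_hom i g) (unit_hom X))); split.
  move=> X Y f; apply: rmap_inj => /=.
  by rewrite unit_map_nat -comp_assoc split_unit_map comp_idl.
move=> X1 X2 Y1 Y2 f1 f2 g1 g2 /(f_equal (@rmap _ _ _ _)) /= E; apply: rmap_inj.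
rewrite /= (comp_assoc (split_map _)) (comp_assoc (rmap g2)) -unit_map_nat.
rewrite -(comp_assoc (rmap g2)) E -(comp_assoc (rmap f2)) -split_map_nat.
by rewrite !comp_assoc.
Qed.

End Splitting.
End InductionSeparable.
End InductionRestriction.

Theorem theorem3p5 (C : StrictMonoidalCategory) (coeqs : Coequalizers C)
    (hgen : left_tensor_generator (tunit C))
    (R S : Algebra C) (i : AlgebraMorphism R S) (hS : left_coflat (acar S)) :
  (forall hr : (forall X : C, right_coflat X),
    separable (restriction i) <->
    exists e : Hom (tunit C) (SRS coeqs i),
      SRS_lact coeqs i (hr (acar S)) \o idm (acar S) <x> e \o run_inv (acar S) =
        SRS_ract coeqs i hS \o e <x> idm (acar S) \o lun_inv (acar S) /\
      SRS_mul coeqs i \o e = aone S) /\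
  (separable (induction coeqs i hS) <->
    exists theta : BimoduleHom (restrict_bimodule i (regular_bimodule S))
                               (regular_bimodule R),
      bmap theta \o aone S = aone R).
Proof.
split=> [hr|]; split.
- exact: casimir_of_separable.
- by case=> e [e_central e_split]; apply: separable_of_casimir e_central e_split.
- exact: splitting_of_separable.
- by case=> theta theta_1; apply: separable_of_splitting theta_1.
Qed.
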